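(* Let $n\ge 3$, let $G_1,\ldots,G_n$ be independent standard Gaussian random variables, and let $X_{(1)}\ge\ldots\ge X_{(n)}$ be the order statistics of $|G_1|,\ldots,|G_n|$. Then for every integer $k$ with $1\le k\le n/2$, $$\operatorname{Var}[X_{(k)}]\le \frac{1}{k\log 2}\cdot\frac{8}{\log\frac{2n}{k}-\log\left(1+\frac{4}{k}\log\log\frac{2n}{k}\right)}.$$
   Context: The order statistics are the non-increasing rearrangement of the sample; $\log$ is the natural logarithm. *)

(* Defs.v *)
From HB Require Import structures.
From mathcomp Require Import all_boot all_order all_algebra.
From mathcomp Require Import all_classical all_reals all_analysis.

Set Implicit Arguments.
Unset Strict Implicit.
Unset Printing Implicit Defensive.

Import Order.TTheory GRing.Theory Num.Theory.
Import numFieldNormedType.Exports.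

Local Open Scope classical_set_scope.
Local Open Scope ring_scope.

Definition mutually_independent (d : measure_display) (T : measurableType d)
    (R : realType) (P : probability T R) (I : finType)
    (X : I -> {RV P >-> R}) : Prop :=
  forall (J : {set I}) (A : I -> set R), (forall i, measurable (A i)) ->
    P (\bigcap_(i in [set` J]) X i @^-1` A i) =
    (\prod_(i in J) P (X i @^-1` A i))%E.

Arguments mutually_independent {d T R} P {I} X.

(* The laws are compared on Borel sets only: a measure is an arbitrary function
   outside the measurable sets. The parameters of [normal_prob] are the mean and
   the standard deviation. *)
Definition standard_gaussian (d : measure_display) (T : measurableType d)
    (R : realType) (P : probability T R) (X : {RV P >-> R}) : Prop :=
  forall A : set R, measurable A ->
    distribution P X A = normal_prob 0 1 A.

Arguments standard_gaussian {d T R} P X.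

(* [order_stat x k] is x_(k) in the non-increasing rearrangement
   x_(1) >= ... >= x_(n), numbered from 1; it is meaningful for 1 <= k <= n. *)
Definition order_stat (R : realType) (n : nat) (x : 'I_n -> R) (k : nat) : R :=
  nth 0 (sort >=%R [seq x i | i : 'I_n]) k.-1.

(* Main.v *)
(* Let S(x) = P(|G| > x), choose a >= 0 with S(a) = k/n and let h = - S'(a)/S(a)
   be the hazard rate of |G| at a. The hazard rate is nondecreasing and S is
   convex on [0, +oo[, so that S(a + u/h) <= (k/n) exp(- u) and
   S(a - u/h) >= (k/n) (1 + u). Since X_(k) > t means that at least k of the
   |G_i| exceed t, Chernoff's bound for the number of such i gives
     P(X_(k) > a + u/h) <= exp(- k (u - 1 + exp(- u))),
     P(X_(k) < a - u/h) <= (1 + u)^(k-1) exp(- k u).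
   Integrating these tails against 2 u du yields
     Var X_(k) <= E (X_(k) - a)^2 <= (2 e + 2) / (k h^2),
   and Mills' inequality a <= h gives h^2 >= (ln 2) (1 + e)/4 * ln (2n/k). *)
Require Import Defs.
From HB Require Import structures.
From mathcomp Require Import all_boot all_order all_algebra.
From mathcomp Require Import all_classical all_reals all_analysis.
From mathcomp Require Import measurable_realfun ring lra zify.

Set Implicit Arguments.
Unset Strict Implicit.
Unset Printing Implicit Defensive.

Import Order.TTheory GRing.Theory Num.Theory.
Import numFieldNormedType.Exports.

Local Open Scope classical_set_scope.
Local Open Scope ring_scope.

(** * Derivation rules and numerical bounds *)

Section derivation_rules.
Variable R : realType.
Implicit Types (f g : R -> R) (x a b : R).

Lemma is_derive1_id x : is_derive x 1 (fun y : R => y) 1.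
Proof. exact: is_derive_id. Qed.

Lemma is_derive1_cst (c : R) x : is_derive x 1 (fun=> c) 0.
Proof. exact: is_derive_cst. Qed.

Lemma is_derive1D f g x a b : is_derive x 1 f a -> is_derive x 1 g b ->
  is_derive x 1 (fun y => f y + g y) (a + b).
Proof. by move=> ? ?; exact: is_deriveD. Qed.

Lemma is_derive1N f x a : is_derive x 1 f a ->
  is_derive x 1 (fun y => - f y) (- a).
Proof. by move=> ?; exact: is_deriveN. Qed.

Lemma is_derive1M f g x a b : is_derive x 1 f a -> is_derive x 1 g b ->
  is_derive x 1 (fun y => f y * g y) (a * g x + f x * b).
Proof.
move=> df dg; apply: (is_derive_eq (is_deriveM df dg)).
by rewrite /GRing.scale/= addrC mulrC.
Qed.

Lemma is_derive1X f n x a : is_derive x 1 f a ->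
  is_derive x 1 (fun y => f y ^+ n) (n%:R * f x ^+ n.-1 * a).
Proof.
move=> df; rewrite (_ : (fun y => f y ^+ n) = f ^+ n).
  exact: (is_deriveX n df).
by apply/funext => y; rewrite exprfctE.
Qed.

Lemma is_derive1V f x a : f x != 0 -> is_derive x 1 f a ->
  is_derive x 1 (fun y => (f y)^-1) (- a / f x ^+ 2).
Proof.
move=> fx0 df; apply: (is_derive_eq (is_deriveV fx0 df)).
by rewrite /GRing.scale/= mulNr mulrC mulNr.
Qed.

Lemma is_derive1_expR f x a : is_derive x 1 f a ->
  is_derive x 1 (fun y => expR (f y)) (expR (f x) * a).
Proof. by move=> df; apply: is_derive1_comp. Qed.

Lemma is_derive_itv_le f (df : R -> R) a b : a <= b ->
  (forall x, a <= x <= b -> is_derive x 1 f (df x)) ->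
  (forall x, a < x < b -> 0 <= df x) -> f a <= f b.
Proof.
move=> ab fdf df0.
have [->//|aNb] := eqVneq a b; have {ab aNb} ab : a < b by rewrite lt_neqAle aNb.
have [||c] := @MVT R f df a b ab.
- by move=> x; rewrite in_itv/= => /andP[/ltW ax /ltW xb]; apply: fdf; rewrite ax.
- apply: derivable_within_continuous => x; rewrite in_itv/= => xab.
  by have [] := fdf x xab.
- rewrite in_itv/= => cab E.
  by rewrite -subr_ge0 E mulr_ge0 ?df0// subr_ge0 ltW.
Qed.

End derivation_rules.

(** The derivative is an existential variable filled in by the rules. [notypeclasses refine] leaves
    the premises as subgoals for the repetition instead of handing them to instance resolution. *)
Ltac derive_step := first
  [ multimatch goal with H : is_derive _ _ _ _ |- _ => exact H end
  | notypeclasses refine (is_derive1_id _)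
  | notypeclasses refine (is_derive1_cst _ _)
  | notypeclasses refine (is_derive1D _ _)
  | notypeclasses refine (is_derive1N _)
  | notypeclasses refine (is_derive1M _ _)
  | notypeclasses refine (is_derive1X _ _)
  | notypeclasses refine (is_derive1_expR _)
  | exact: is_derive_expR | exact: is_derive_sin | exact: is_derive_cos ].
Ltac derive_fun :=
  notypeclasses refine (is_derive_eq _ _); [repeat derive_step |].

Section elementary_bounds.
Variable R : realType.

(** From exp(-1/64) >= 63/64 one gets e <= (64/63)^64. This power is computed by six squarings, each
    rounded up to keep the fractions short. *)
Lemma expR1_le : expR 1 <= 11 / 4 :> R.
Proof.
have e0 := expR_gt0 (1 : R).
have h (x : R) : 0 < x -> x <= expR (- 64^-1) -> expR 1 <= x^-1 ^+ 64.
  move=> x0 hx.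
  have -> : (1 : R) = 64%:R * 64^-1 by rewrite divff.
  rewrite expRM_natl; apply: lerXn2r; rewrite ?nnegrE ?invr_ge0 ?expR_ge0 ?(ltW x0)//.
  by rewrite -[leLHS]invrK -expRN lef_pV2 ?posrE ?expR_gt0.
have /h : 0 < 63 / 64 :> R by lra.
have -> : 63 / 64 = 1 + (- 64^-1) :> R by lra.
move=> /(_ (expR_ge1Dx _)).
have -> : 1 + - 64^-1 = 63 / 64 :> R by lra.
rewrite invf_div => /le_trans; apply.
have sq (x y z : R) : 0 <= x -> x <= y -> y ^+ 2 <= z -> 0 <= x ^+ 2 /\ x ^+ 2 <= z.
  move=> x0 xy yz; split; first exact: sqr_ge0.
  by apply: le_trans yz; rewrite lerXn2r// nnegrE ?(le_trans x0).
rewrite (_ : 64 = 2 * 2 * 2 * 2 * 2 * 2)%N// !exprM.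
have [h0 h1] : 0 <= 64 / 63 :> R /\ 64 / 63 <= 64 / 63 :> R by lra.
have {h0 h1} [|h0 h1] := sq _ _ (1032 / 1000) h0 h1; first lra.
have {h0 h1} [|h0 h1] := sq _ _ (10651 / 10000) h0 h1; first lra.
have {h0 h1} [|h0 h1] := sq _ _ (11345 / 10000) h0 h1; first lra.
have {h0 h1} [|h0 h1] := sq _ _ (12871 / 10000) h0 h1; first lra.
have {h0 h1} [|h0 h1] := sq _ _ (16567 / 10000) h0 h1; first lra.
by have {h0 h1} [|h0 h1] := sq _ _ (11 / 4) h0 h1; first lra.
Qed.

Lemma expR_ge_taylor2 (x : R) : 0 <= x -> 1 + x + x ^+ 2 / 2 <= expR x.
Proof.
move=> x0; rewrite -subr_ge0.
have -> : 0 = expR 0 - (1 + 0 + 0 ^+ 2 / 2) :> R by rewrite expR0; lra.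
apply: (@is_derive_itv_le _ (fun y => expR y - (1 + y + y ^+ 2 / 2))
  (fun y => expR y - (1 + y)) 0 x) => // y _.
  by derive_fun => /=; lra.
by rewrite subr_ge0 expR_ge1Dx.
Qed.

(** The quadratic Taylor bound gives exp(7/40) >= 119/100; two squarings, the first rounded down to
    1415/1000, then reach 2. *)
Lemma ln2_le : ln 2 <= 7 / 10 :> R.
Proof.
rewrite -[leRHS]expRK ler_ln ?posrE ?expR_gt0//.
have -> : 7 / 10 = 4%:R * (7 / 40) :> R by lra.
rewrite expRM_natl.
have h : 119 / 100 <= expR (7 / 40 : R).
  by apply: le_trans (expR_ge_taylor2 _); lra.
have sq (y z x : R) : 0 <= y -> y <= x -> z <= y ^+ 2 -> z <= x ^+ 2.
  move=> y0 xy yz; apply: (le_trans yz).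
  by rewrite lerXn2r// nnegrE ?(le_trans y0).
rewrite (exprM _ 2 2); apply: (sq (1415 / 1000)); [lra| |lra].
by apply: (sq (119 / 100)); [lra| exact: h |lra].
Qed.

(** Starting from 1 - cos >= 0, each Taylor remainder vanishes at 0 and has the preceding one as
    derivative, hence is nonnegative in turn. *)
Lemma cos_le_taylor4 (x : R) : 0 <= x ->
  cos x <= 1 - x ^+ 2 / 2 + x ^+ 4 / 24.
Proof.
have mono (f df : R -> R) (y : R) : 0 <= y -> f 0 = 0 ->
    (forall z : R, is_derive z 1 f (df z)) ->
    (forall z : R, 0 <= z -> 0 <= df z) ->
    0 <= f y.
  move=> y0 f0 fdf df0; rewrite -f0; apply: (is_derive_itv_le y0) => // z.
  by move=> /andP[/ltW + _]; exact: df0.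
have sin_le (y : R) : 0 <= y -> 0 <= y - sin y.
  move=> y0; apply: (mono (fun y => y - sin y) (fun y => 1 - cos y)).
  - exact: y0.
  - by rewrite sin0 subr0.
  - by move=> z _; rewrite subr_ge0 cos_le1.
have cos_ge (y : R) : 0 <= y -> 0 <= cos y + (-1 + y ^+ 2 / 2).
  move=> y0.
  apply: (mono (fun y => cos y + (-1 + y ^+ 2 / 2)) (fun y => y - sin y)).
  - exact: y0.
  - by rewrite cos0; lra.
  - by move=> z; derive_fun => /=; lra.
  - exact: sin_le.
have sin_ge (y : R) : 0 <= y -> 0 <= sin y + (- y + y ^+ 3 / 6).
  move=> y0.
  apply: (mono (fun y => sin y + (- y + y ^+ 3 / 6))
     (fun y => cos y + (-1 + y ^+ 2 / 2))).
  - exact: y0.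
  - by rewrite sin0; lra.
  - by move=> z; derive_fun => /=; lra.
  - exact: cos_ge.
move=> x0; rewrite -subr_ge0.
apply: (mono (fun x => 1 - x ^+ 2 / 2 + x ^+ 4 / 24 - cos x)
     (fun y => sin y + (- y + y ^+ 3 / 6))).
- exact: x0.
- by rewrite cos0; lra.
- by move=> z; derive_fun => /=; lra.
- exact: sin_ge.
Qed.

(** Otherwise 8/5 < pi/2 and cos(8/5) > 0, whereas the quartic Taylor bound is negative at 8/5. *)
Lemma pi_le : pi <= 16 / 5 :> R.
Proof.
rewrite leNgt; apply/negP => pi_gt.
have := @cos_gt0_pihalf R (8 / 5); have := @cos_le_taylor4 (8 / 5).
have := @pi_ge2 R.
lra.
Qed.

End elementary_bounds.

(** * The half-normal distribution *)

Section half_normal.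
Variable R : realType.
Implicit Types x y t a : R.

Definition half_normal_pdf x : R := 2 * normal_pdf 0 1 x.

(** Written through the normal cdf, it is differentiable on the whole line; it is the probability of
    |G| > x for x >= 0. *)
Definition half_normal_tail x : R :=
  1 - (fine (normal_prob 0 1 `]-oo, x]) - fine (normal_prob 0 1 `]-oo, - x])).

Lemma half_normal_pdfE x :
  half_normal_pdf x = 2 * normal_peak 1 * expR (- (x ^+ 2 / 2)).
Proof.
rewrite /half_normal_pdf normal_pdfE ?oner_neq0//= /normal_fun subr0 expr1n.
by rewrite mulrA mulNr.
Qed.

Lemma half_normal_peak2 : (2 * normal_peak 1) ^+ 2 = 2 / pi :> R.
Proof.
rewrite /normal_peak expr1n mul1r exprMn exprVn sqr_sqrtr; last first.
  by rewrite mulrn_wge0// pi_ge0.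
move: (pi_gt0 R); generalize (pi : R) => q q0.
by rewrite -(mulr_natr q); field; rewrite gt_eqF.
Qed.

Lemma is_derive_half_normal_pdf x :
  is_derive x 1 half_normal_pdf (- x * half_normal_pdf x).
Proof.
rewrite (_ : half_normal_pdf =
  fun x => 2 * normal_peak 1 * expR (- (x ^+ 2 / 2))); last first.
  by apply/funext => y; rewrite half_normal_pdfE.
by derive_fun => /=; field.
Qed.

Lemma is_derive_normal_cdf x : is_derive x 1
  (fun y => fine (normal_prob 0 1 `]-oo, y]) : R) (normal_pdf 0 1 x).
Proof.
have [] := @continuous_FTC1 R (normal_pdf 0 1) -oo%O x (x + 1).
- by rewrite ltrDl.
- by apply: integrableS (integrable_normal_pdf 0 1).
- by rewrite /= ltNyr.
- exact/continuous_normal_pdf/oner_neq0.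
move=> dF F'; have := derivableP dF.
by rewrite -derive1E F'.
Qed.

Lemma normal_pdfN x : normal_pdf 0 1 (- x) = normal_pdf 0 1 x :> R.
Proof. by rewrite !normal_pdfE ?oner_neq0//= /normal_fun !subr0 sqrrN. Qed.

Lemma is_derive_half_normal_tail x :
  is_derive x 1 half_normal_tail (- half_normal_pdf x).
Proof.
have d1 := is_derive_normal_cdf x.
have d2 := is_derive1_comp (is_derive_normal_cdf (- x))
  (is_derive1N (is_derive1_id x)).
rewrite /half_normal_tail.
derive_fun; by rewrite normal_pdfN /half_normal_pdf; lra.
Qed.

Lemma half_normal_tail_prob x : 0 <= x ->
  normal_prob 0 1 [set y | x < `|y|] = (half_normal_tail x)%:E.
Proof.
move=> x0; pose V := normal_prob (0 : R) 1 : probability _ R.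
have -> : [set y : R | x < `|y|] = ~` `]-oo, x] `|` `]-oo, - x[.
  rewrite setCitvl; apply/seteqP; split=> y /=; rewrite !in_itv/= andbT ltrNr.
    by rewrite ltr_normr => /orP.
  by rewrite ltr_normr => /orP.
have VN : normal_prob 0 1 `]-oo, - x[ = normal_prob 0 1 `]-oo, - x] :> \bar R.
  rewrite /normal_prob integral_itv_bndo_bndc//.
  apply/measurable_EFinP/measurable_funTS; exact: measurable_normal_pdf.
set A := (X in ~` X `|` _); set B := (X in _ `|` X).
have mA : measurable A by exact: measurable_itv.
have mB : measurable B by exact: measurable_itv.
have VD : V (~` A `|` B) = (V (~` A) + V B)%E.
  apply: measureU => //; first exact: measurableC.
  rewrite /A setCitvl -subset0 => y /=; rewrite !in_itv/= andbT => -[xy yx].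
  by have := lt_trans xy yx; lra.
have VC : V (~` A) = (1 - V A)%E by exact: probability_setC.
have VK (C : set R) : measurable C -> V C = (fine (V C))%:E.
  by move=> mC; rewrite fineK//; exact: (fin_num_measure V).
have VB : V B = (fine (normal_prob (0 : R) 1 `]-oo, - x]))%:E.
  by rewrite [LHS]VN; exact: VK.
rewrite [LHS]VD VC VB (VK _ mA) -EFinB -EFinD; congr EFin.
by rewrite /half_normal_tail opprB addrA addrAC.
Qed.

Lemma half_normal_tail0 : half_normal_tail 0 = 1.
Proof. by rewrite /half_normal_tail oppr0 subrr subr0. Qed.

(** As a random variable under the normal law, the identity has the normal cdf, so that general
    limits of cdfs apply. *)
Let idR : measurableTypeR R -> R := idfun.

#[local] HB.instance Definition _ :=
  @isMeasurableFun.Build _ _ _ _ idR (@measurable_id _ _ setT).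

Lemma cvg_half_normal_tail : half_normal_tail x @[x --> +oo] --> (0 : R).
Proof.
pose V := normal_prob (0 : R) 1 : probability (measurableTypeR R) R.
have Fy : fine (normal_prob (0 : R) 1 `]-oo, x]) @[x --> +oo] --> (1 : R).
  exact: fine_cvg (@cvg_cdfy1 _ _ R V idR).
have FNy : fine (normal_prob (0 : R) 1 `]-oo, - x]) @[x --> +oo] --> (0 : R).
  by apply/(cvgNy_compNP (fun x => fine (normal_prob (0 : R) 1 `]-oo, x])));
    exact: fine_cvg (@cvg_cdfNy0 _ _ R V idR).
have -> : 0 = 1 - (1 - 0) :> R by rewrite subr0 subrr.
by apply: cvgB; [exact: cvg_cst|exact: cvgB].
Qed.

Lemma half_normal_tail_small x e : 0 < e ->
  exists2 y, x <= y & half_normal_tail y < e.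
Proof.
move=> e0; have /cvgrPdist_lt/(_ _ e0) ty := cvg_half_normal_tail.
near (+oo : set_system R) => y; exists y; first by near: y; apply: nbhs_pinfty_ge; exact: num_real.
rewrite (le_lt_trans (ler_norm _))// -normrN -sub0r; near: y; exact: ty.
Unshelve. all: by end_near. Qed.

Lemma half_normal_pdf_gt0 x : 0 < half_normal_pdf x.
Proof.
by rewrite half_normal_pdfE mulr_gt0 ?expR_gt0// mulr_gt0// normal_peak_gt0 ?oner_neq0.
Qed.

Lemma half_normal_pdf_le x y : 0 <= x -> x <= y ->
  half_normal_pdf y <= half_normal_pdf x.
Proof.
move=> x0 xy; rewrite !half_normal_pdfE ler_wpM2l ?mulr_ge0 ?normal_peak_ge0//.
by rewrite ler_expR lerN2 ler_pM2r// lerXn2r// nnegrE// (le_trans x0).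
Qed.

Lemma half_normal_tail_ge0 x : 0 <= x -> 0 <= half_normal_tail x.
Proof.
by move=> x0; rewrite -lee_fin -half_normal_tail_prob.
Qed.

Lemma half_normal_tail_decr x y : x < y -> half_normal_tail y < half_normal_tail x.
Proof.
move=> xy; have [||c] := @MVT R half_normal_tail (fun z => - half_normal_pdf z) _ _ xy.
- by move=> z _; exact: is_derive_half_normal_tail.
- apply: derivable_within_continuous => z _.
  by have [] := is_derive_half_normal_tail z.
- by move=> _ E; rewrite -subr_lt0 E nmulr_rlt0 ?subr_gt0// oppr_lt0 half_normal_pdf_gt0.
Qed.

Lemma half_normal_tail_gt0 x : 0 <= x -> 0 < half_normal_tail x.
Proof.
move=> x0; apply: le_lt_trans (half_normal_tail_decr (_ : x < x + 1)).
  by rewrite half_normal_tail_ge0// addr_ge0.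
by rewrite ltrDl.
Qed.

(** With f the density and S the tail, z |-> - f(z) + x S(z) has derivative (z - x) f(z) >= 0 for z
    >= x. Compare its values at x and at a point y so far out that x S(y) <= e. *)
Lemma half_normal_mills x : 0 <= x -> x * half_normal_tail x <= half_normal_pdf x.
Proof.
move=> x0; apply/ler_addgt0Pr => e e0.
(* Dividing by x + 1 rather than x covers x = 0. *)
have e'0 : 0 < e / (x + 1) by rewrite divr_gt0// ltr_wpDl.
have [y xy ty] := half_normal_tail_small x e'0.
have : - half_normal_pdf x + x * half_normal_tail x <=
    - half_normal_pdf y + x * half_normal_tail y.
  apply: (is_derive_itv_le (f := fun z => - half_normal_pdf z + x * half_normal_tail z)
    (df := fun z => (z - x) * half_normal_pdf z) xy) => z.
    move=> _; have dp := is_derive_half_normal_pdf z.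
    by have dt := is_derive_half_normal_tail z; derive_fun => /=; ring.
  by move=> /andP[xz _]; rewrite mulr_ge0 ?subr_ge0 ?ltW// half_normal_pdf_gt0.
have : x * half_normal_tail y <= e.
  rewrite (le_trans (ler_wpM2l x0 (ltW ty)))// mulrA ler_pdivrMr ?ltr_wpDl//.
  by rewrite mulrC ler_wpM2l ?lerDl// ltW.
have := half_normal_pdf_gt0 y; lra.
Qed.

Definition half_normal_hazard x := half_normal_pdf x / half_normal_tail x.

Lemma half_normal_hazard_gt0 x : 0 <= x -> 0 < half_normal_hazard x.
Proof. by move=> x0; rewrite divr_gt0 ?half_normal_pdf_gt0 ?half_normal_tail_gt0. Qed.

Lemma half_normal_hazard_ge x : 0 <= x -> x <= half_normal_hazard x.
Proof.
by move=> x0; rewrite ler_pdivlMr ?half_normal_tail_gt0// half_normal_mills.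
Qed.

(** The derivative of f / S is (f / S^2) (f - z S), nonnegative by Mills' inequality. *)
Lemma half_normal_hazard_le x y : 0 <= x -> x <= y ->
  half_normal_hazard x <= half_normal_hazard y.
Proof.
move=> x0 xy.
apply: (is_derive_itv_le (df := fun z => half_normal_pdf z / half_normal_tail z ^+ 2 *
   (half_normal_pdf z - z * half_normal_tail z)) xy) => z /andP[xz zy].
  have t0 := half_normal_tail_gt0 (le_trans x0 xz).
  have dp := is_derive_half_normal_pdf z.
  have dt := is_derive1V (lt0r_neq0 t0) (is_derive_half_normal_tail z).
  rewrite /half_normal_hazard; derive_fun => /=; field.
  by rewrite gt_eqF.
have z0 : 0 <= z by rewrite (le_trans x0)// ltW.
rewrite mulr_ge0 ?subr_ge0 ?half_normal_mills//.
by rewrite divr_ge0 ?sqr_ge0 ?(ltW (half_normal_pdf_gt0 _)).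
Qed.

(** The product S(a + s) exp(h s) is nonincreasing in s, because the hazard rate at a + s is at
    least h, its value at a. *)
Lemma half_normal_tail_right a t : 0 <= a -> 0 <= t ->
  half_normal_tail (a + t) <= half_normal_tail a * expR (- (half_normal_hazard a * t)).
Proof.
move=> a0 t0; rewrite expRN ler_pdivlMr ?expR_gt0//.
(* The right-hand side becomes the value of this product at s = 0. *)
rewrite -[half_normal_tail a]mulr1 -[in leRHS](expR0 R) -[in leRHS](mulr0 (half_normal_hazard a)).
rewrite -[in half_normal_tail a](addr0 a) -lerN2.
apply: (is_derive_itv_le
  (f := fun s => - (half_normal_tail (a + s) * expR (half_normal_hazard a * s)))
  (df := fun s => expR (half_normal_hazard a * s) *
     (half_normal_pdf (a + s) - half_normal_hazard a * half_normal_tail (a + s))) t0)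
  => s /andP[s0 st].
  have dt := is_derive1_comp (is_derive_half_normal_tail (a + s))
    (is_derive1D (is_derive1_cst a s) (is_derive1_id s)).
  by derive_fun => /=; ring.
rewrite mulr_ge0 ?expR_ge0// subr_ge0 -ler_pdivlMr.
  by rewrite half_normal_hazard_le// lerDl ltW.
by rewrite half_normal_tail_gt0// addr_ge0// ltW.
Qed.

(** The tail lies above its tangent at a, since the density is nonincreasing on the nonnegative
    half-line; t <= a keeps a - s there. *)
Lemma half_normal_tail_left a t : 0 <= t -> t <= a ->
  half_normal_tail a * (1 + half_normal_hazard a * t) <= half_normal_tail (a - t).
Proof.
move=> t0 ta; have a0 := le_trans t0 ta.
have hE : half_normal_tail a * half_normal_hazard a = half_normal_pdf a.
  by rewrite mulrC divfK// lt0r_neq0 ?half_normal_tail_gt0.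
rewrite mulrDr mulr1 mulrA hE.
rewrite -subr_ge0.
have -> : 0 = half_normal_tail (a - 0) - (half_normal_tail a + half_normal_pdf a * 0).
  by rewrite subr0 mulr0 addr0 subrr.
apply: (is_derive_itv_le
  (f := fun s => half_normal_tail (a - s) - (half_normal_tail a + half_normal_pdf a * s))
  (df := fun s => half_normal_pdf (a - s) - half_normal_pdf a) t0)
  => s /andP[s0 st].
  have dt := is_derive1_comp (g := fun s => a - s) (is_derive_half_normal_tail (a - s))
    (is_derive1D (is_derive1_cst a s) (is_derive1N (is_derive1_id s))).
  by derive_fun => /=; ring.
rewrite subr_ge0 half_normal_pdf_le//; last by rewrite gerBl ltW.
by rewrite subr_ge0 (le_trans (ltW st)).
Qed.

Lemma half_normal_tail_surj s : 0 < s -> s <= 1 ->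
  exists2 a, 0 <= a & half_normal_tail a = s.
Proof.
move=> s0 s1; have [y y0 ys] := half_normal_tail_small 0 s0.
have [||a] := @IVT R half_normal_tail 0 y s y0.
- apply: derivable_within_continuous => z _.
  by have [] := is_derive_half_normal_tail z.
- rewrite half_normal_tail0 ge_min le_max s1 (ltW ys)/= orbT.
  by rewrite /= ?andbT.
by rewrite in_itv/= => /andP[a0 _] <-; exists a.
Qed.

End half_normal.

(** * Logarithmic lower bound on the squared hazard rate *)

Section hazard_bound.
Variable R : realType.
Implicit Types x a : R.

Lemma ln_le_subr1 x : 0 < x -> ln x <= x - 1.
Proof.
move=> x0; rewrite -ler_expR lnK//.
by apply: le_trans (expR_ge1Dx _); rewrite addrC subrK.
Qed.

Lemma ln2_ge0 : 0 <= ln 2 :> R.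
Proof. by apply: ln_ge0; lra. Qed.

(** The constant on the left is at most 21/32, and (21/32) (h^2 + 9/20) <= h^2 as soon as h^2 >=
    9/10. *)
Lemma half_normal_hazard_log a : 0 <= a -> half_normal_tail a <= 1 / 2 ->
  ln 2 * (1 + expR 1) / 4 * ln (2 / half_normal_tail a) <= half_normal_hazard a ^+ 2.
Proof.
move=> a0 S12.
set S := half_normal_tail a in S12 *; set h := half_normal_hazard a.
have ah : a <= h by exact: half_normal_hazard_ge.
have S0 : 0 < S by exact: half_normal_tail_gt0.
have h0 : 0 < h by exact: half_normal_hazard_gt0.
have pi0 := pi_gt0 R.
have h2E : h ^+ 2 = 2 / pi * expR (- a ^+ 2) / S ^+ 2.
  rewrite /h /half_normal_hazard expr_div_n half_normal_pdfE exprMn.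
  rewrite half_normal_peak2 -expRM_natl; congr (_ * expR _ / _).
  by field.
clearbody S h.
(* Together with [a <= h], this turns [ln (2 / S)] into at most [h^2 + 9/20]. *)
have SE : (2 / S) ^+ 2 = 2 ^+ 3 * (pi / 4) * h ^+ 2 * expR (a ^+ 2).
  rewrite h2E expRN; move: pi0; generalize (pi : R) => q q0; field.
  by rewrite !gt_eqF ?expR_gt0.
have pi40 : 0 < pi / 4 :> R by rewrite divr_gt0.
have LE : 2 * ln (2 / S) = 3 * ln 2 + ln (pi / 4) + ln (h ^+ 2) + a ^+ 2.
  have -> : 2 * ln (2 / S) = ln ((2 / S) ^+ 2).
    by rewrite lnXn ?divr_gt0// mulr_natl.
  rewrite SE !lnM ?posrE ?mulr_gt0 ?exprn_gt0 ?expR_gt0//.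
  by rewrite expRK; ring.
(* Using ln y <= y - 1 for y = pi/4 and y = h^2, the constants in [LE] add up to at most 3 (7/10) +
   4/5 - 2 = 9/10. *)
have L_le : ln (2 / S) <= h ^+ 2 + 9 / 20.
  have := ln_le_subr1 pi40; have := ln_le_subr1 (exprn_gt0 2 h0).
  have : a ^+ 2 <= h ^+ 2.
    by rewrite lerXn2r ?nnegrE ?(ltW h0).
  have := pi_le R; have := ln2_le R; lra.
(* If a >= 1, use a <= h. Otherwise exp(- a^2) >= 1/e >= 4/11, and the explicit formula gives (5/8)
   (4/11) 4 = 10/11. *)
have h2_ge : 9 / 10 <= h ^+ 2.
  have [a1|a1] := leP 1 a.
    have : 1 ^+ 2 <= h ^+ 2 by rewrite lerXn2r ?nnegrE ?(ltW h0)// (le_trans a1).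
    by rewrite expr1n; lra.
  have S2 : 4 <= S ^- 2.
    rewrite -[4]invrK lef_pV2 ?posrE ?exprn_gt0 ?invr_gt0//.
    have : S ^+ 2 <= (1 / 2) ^+ 2 by rewrite lerXn2r ?nnegrE ?(ltW S0)//; lra.
    by lra.
  have e4 : 4 / 11 <= expR (- a ^+ 2) :> R.
    have eq : (11 / 4)^-1 = 4 / 11 :> R by lra.
    rewrite expRN -eq lef_pV2 ?posrE ?expR_gt0//.
    apply: le_trans (expR1_le R); rewrite ler_expR.
    by apply: exprn_ile1 => //; exact: ltW.
  have p2 : 5 / 8 <= 2 / pi :> R.
    by rewrite ler_pdivlMr//; have := pi_le R; lra.
  rewrite h2E; apply: (@le_trans _ _ (5 / 8 * (4 / 11) * 4)); first lra.
  apply: ler_pM => //.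
  by apply: ler_pM => //; lra.
have c_le : ln 2 * (1 + expR 1) / 4 <= 21 / 32 :> R.
  have : ln 2 * (1 + expR 1) <= 7 / 10 * (15 / 4) :> R.
    rewrite ler_pM ?ln2_ge0 ?addr_ge0 ?expR_ge0 ?ln2_le//.
    by have := expR1_le R; lra.
  by lra.
have L0 : 0 <= ln (2 / S).
  by apply: ln_ge0; rewrite ler_pdivlMr//; lra.
apply: (@le_trans _ _ (21 / 32 * ln (2 / S))); first by rewrite ler_wpM2r.
by lra.
Qed.

End hazard_bound.

(** * An explicit primitive dominating the two tails *)

Section tail_primitive.
Variables (R : realType) (k : nat).
Hypothesis k_gt0 : (0 < k)%N.
Implicit Types u : R.

(** These are Poisson Chernoff bounds: [upper_tail] for a mean k exp(- u) and a value at least k,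
    with parameter exp(u); [lower_tail] for a mean k (1 + u) and a value at most k - 1, with
    parameter 1 / (1 + u). *)
Definition upper_tail u : R := expR (- (k%:R * (u - 1 + expR (- u)))).
Definition lower_tail u : R := (1 + u) ^+ k.-1 * expR (- (k%:R * u)).

(* [2 u lower_tail u] is the derivative of the last summand (with its [1 / k]). For
   [upper_tail], [u <= (1 + u) (1 - exp (- u))] and
   [k (1 - exp (- u)) upper_tail u = - upper_tail^`() u], so that differentiating
   [- (2 / k) (1 + u) upper_tail u] leaves the defect [- (2 / k) upper_tail u],
   which the middle summand compensates: its derivative is [2 / k] times the
   value of [upper_tail] at [k = 1]. *)
Definition tail_primitive u : R := k%:R^-1 * (- (2 * ((1 + u) * upper_tail u))
  + 2 * (expR 1 * expR (- expR (- u))) - 2 * ((1 + u) ^+ k * expR (- (k%:R * u)))).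

Definition tail_density u : R := k%:R^-1 * (
    2 * (expR 1 * (expR (- u) * expR (- expR (- u))) - upper_tail u)
  + 2 * k%:R * ((1 + u) * (1 - expR (- u)) * upper_tail u)
  + 2 * k%:R * (u * lower_tail u)).

Let kR_gt0 : 0 < k%:R :> R. Proof. by rewrite ltr0n. Qed.

Lemma is_derive_tail_primitive u : is_derive u 1 tail_primitive (tail_density u).
Proof.
rewrite /tail_primitive /tail_density /upper_tail /lower_tail.
derive_fun => /=.
have -> : (1 + u) ^+ k = (1 + u) * (1 + u) ^+ k.-1 by rewrite -exprS prednK.
by field; rewrite gt_eqF.
Qed.

Lemma continuous_tail_density : continuous tail_density.
Proof.
move=> u; apply: differentiable_continuous; apply/derivable1_diffP.
have [d [//]] : exists d, is_derive u 1 tail_density d.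
rewrite /tail_density /upper_tail /lower_tail.
by eexists; repeat derive_step.
Qed.

(** Since u - 1 + exp(- u) >= 0, [upper_tail] is largest at k = 1, where it equals the right-hand
    side. *)
Lemma upper_tail_le u : 0 <= u ->
  upper_tail u <= expR 1 * (expR (- u) * expR (- expR (- u))).
Proof.
move=> u0; rewrite -!expRD ler_expR.
have g0 : 0 <= u - 1 + expR (- u) by have := expR_ge1Dx (- u); lra.
have : 1 * (u - 1 + expR (- u)) <= k%:R * (u - 1 + expR (- u)).
  by rewrite ler_wpM2r// ler1n.
by lra.
Qed.

(** The first summand of the density is nonnegative, the second dominates the upper tail because (1
    + u) exp(- u) <= 1, and the third is the lower tail term itself. *)
Lemma tail_density_ge u : 0 <= u ->
  2 * u * (upper_tail u + lower_tail u) <= tail_density u.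
Proof.
move=> u0; have U0 : 0 <= upper_tail u by exact: expR_ge0.
have -> : tail_density u = k%:R^-1 *
    (2 * (expR 1 * (expR (- u) * expR (- expR (- u))) - upper_tail u))
    + 2 * ((1 + u) * (1 - expR (- u)) * upper_tail u) + 2 * (u * lower_tail u).
  by rewrite /tail_density; field; rewrite gt_eqF.
have h1 : 0 <= k%:R^-1 *
    (2 * (expR 1 * (expR (- u) * expR (- expR (- u))) - upper_tail u)).
  by rewrite mulr_ge0 ?invr_ge0 ?ler0n// mulr_ge0// subr_ge0 upper_tail_le.
have h2 : u * upper_tail u <= (1 + u) * (1 - expR (- u)) * upper_tail u.
  rewrite ler_wpM2r// -subr_ge0.
  have -> : (1 + u) * (1 - expR (- u)) - u = 1 - (1 + u) * expR (- u) by ring.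
  by rewrite subr_ge0 expRN ler_pdivrMr ?expR_gt0// mul1r expR_ge1Dx.
by lra.
Qed.

Lemma tail_primitive0 : tail_primitive 0 = - (2 / k%:R).
Proof.
rewrite /tail_primitive /upper_tail oppr0 expR0 mulr0 addr0 expr1n.
rewrite (_ : 0 - 1 + 1 = 0 :> R); last by ring.
rewrite mulr0 oppr0 expR0 expRN divff ?gt_eqF ?expR_gt0//; ring.
Qed.

(** Only the middle summand is positive. With the value - 2 / k at 0, the total increase is at most
    (2 e + 2) / k. *)
Lemma tail_primitive_le u : 0 <= u -> tail_primitive u <= 2 * expR 1 / k%:R.
Proof.
move=> u0; rewrite [leRHS]mulrC ler_wpM2l ?invr_ge0 ?ler0n//.
have h1 : 0 <= (1 + u) * upper_tail u by rewrite mulr_ge0 ?expR_ge0// addr_ge0.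
have h2 : 0 <= (1 + u) ^+ k * expR (- (k%:R * u)).
  by rewrite mulr_ge0 ?expR_ge0// exprn_ge0// addr_ge0.
have h3 : expR 1 * expR (- expR (- u)) <= expR 1.
  by rewrite ler_piMr ?expR_ge0// expR_le1 oppr_le0 expR_ge0.
by lra.
Qed.

End tail_primitive.

(** * Second moments from tail bounds *)

Section layer_cake.
Context d (T : measurableType d) (R : realType) (P : probability T R).

(* The integrand of the layer-cake formula for [Y ^ 2] has the primitive
   [H \o sqrt], which may fail to be differentiable at [0]: the integral is
   first restricted to [[e, +oo[]. *)
Lemma integral_sqr_le (Y : T -> R) (H f : R -> R) (M : R) :
  measurable_fun setT Y -> (forall w, 0 <= Y w) ->
  (forall u : R, is_derive u 1 H (f u)) -> continuous f ->
  (forall u : R, 0 < u -> ((2 * u)%:E * P [set w | u < Y w]%R <= (f u)%:E)%E) ->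
  (forall u : R, 0 <= u -> H u <= M) ->
  (\int[P]_w ((Y w) ^+ 2)%:E <= (M - H 0)%:E)%E.
Proof.
move=> mY Y0 dH cf tailY HM.
have mY2 : measurable_fun setT (fun w => Y w ^+ 2) by exact: measurable_funX.
pose Z : {RV P >-> R} := mfun_Sub (mem_set mY2).
have f0 (u : R) : 0 < u -> 0 <= f u.
  move=> u0; rewrite -lee_fin; apply: le_trans (tailY u u0).
  by rewrite mule_ge0// lee_fin mulr_ge0// ltW.
(* Under r = u^2 the hypothesis [tailY] bounds P(Y^2 > r) by [g r], which is the derivative of [F]
   for r > 0. *)
pose F r := H (Num.sqrt r); pose g r := f (Num.sqrt r) / (2 * Num.sqrt r).
have dF (r : R) : 0 < r -> is_derive r 1 F (g r).
  move=> r0; have := is_derive1_comp (dH (Num.sqrt r)) (is_derive1_sqrt r0).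
  exact.
have FE (r : R) : 0 < r -> (F^`())%classic r = g r.
  by move=> r0; rewrite derive1E; apply: derive_val; exact: dF.
have g0 (r : R) : 0 < r -> 0 <= g r.
  by move=> r0; rewrite divr_ge0 ?f0 ?mulr_ge0 ?sqrtr_ge0// sqrtr_gt0.
have H_nd (u v : R) : 0 <= u -> u <= v -> H u <= H v.
  move=> u0 uv; apply: (is_derive_itv_le uv) => z /andP[uz _].
  by rewrite f0// (le_lt_trans u0).
have F_nd : {homo F : x y / x <= y}.
  by move=> x y xy; rewrite H_nd ?sqrtr_ge0// ler_wsqrtr.
(* Being monotone and bounded by M, [F] has the limit at infinity that the improper integral of [g]
   requires. *)
have Fl : F x @[x --> +oo] --> sup (range F).
  apply: nondecreasing_cvgr => //.
  by exists M => _ [x _ <-]; rewrite HM ?sqrtr_ge0.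
have lM : sup (range F) <= M.
  by apply: ge_sup; [exists (F 0), 0|move=> _ [x _ <-]; rewrite HM ?sqrtr_ge0].
have cg (r : R) : 0 < r -> {for r, continuous g}.
  move=> r0; apply: cvgM.
    by apply: continuous_comp; [exact: sqrt_continuous|exact: cf].
  apply: cvgV; first by rewrite mulf_neq0// gt_eqF ?sqrtr_gt0.
  by apply: cvgM; [exact: cvg_cst|exact: sqrt_continuous].
have tailZ (r : R) : 0 < r -> (ccdf Z r <= (g r)%:E)%E.
  move=> r0; have s0 : 0 < Num.sqrt r by rewrite sqrtr_gt0.
  rewrite /g EFinM lee_pdivlMr ?mulr_gt0// muleC.
  apply: le_trans (tailY _ s0); rewrite lee_wpmul2l ?lee_fin ?mulr_ge0 ?sqrtr_ge0//.
  rewrite /ccdf /distribution/= /pushforward le_measure ?inE//.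
  - by rewrite -[X in measurable X]setTI; apply: (mY2) => //; exact: measurable_itv.
  - rewrite (_ : [set w | _] = setT `&` Y @^-1` `]Num.sqrt r, +oo[%classic).
      by apply: mY => //; exact: measurable_itv.
    by rewrite setTI; apply/seteqP; split => w /=; rewrite in_itv/= andbT.
  - move=> w /=; rewrite !in_itv/= !andbT => rY.
    by rewrite -(ger0_norm (Y0 w)) -sqrtr_sqr ltr_sqrt// (lt_trans r0).
have -> : (\int[P]_w (Y w ^+ 2)%:E)%E = ('E_P[Z])%E by rewrite expectation_def.
rewrite ge0_expectation_ccdf; last by move=> w; exact: sqr_ge0.
(* A probability is at most 1, so the interval from 0 to e contributes at most e. *)
apply/lee_addgt0Pr => e e0.
have mccdf D : measurable_fun D (ccdf Z).
  by apply: measurable_funTS; exact: ccdf_measurable.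
have ccdf0 r : (0 <= ccdf Z r)%E by exact: measure_ge0.
have le1 : (\int[@lebesgue_measure R]_(r in `[0%R, (e : R)[) ccdf Z r <= e%:E)%E.
  have -> : e%:E = (\int[@lebesgue_measure R]_(r in `[0%R, (e : R)[) cst (1 : \bar R) r)%E.
    by rewrite integral_cst//= lebesgue_measure_itv/= lte_fin e0 mul1e oppr0 adde0.
  apply: ge0_le_integral => //=.
    exact: mccdf.
  by move=> r _; exact: probability_le1.
have le2 : (\int[@lebesgue_measure R]_(r in `[(e : R), +oo[) ccdf Z r <= (M - H 0)%:E)%E.
  apply: (@le_trans _ _ (\int[@lebesgue_measure R]_(r in `[(e : R), +oo[) (g r)%:E)%E).
    apply: ge0_le_integral => //=.
    - exact: mccdf.
    - apply/measurable_EFinP.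
      apply: (measurable_funS (E := (`]0, +oo[%classic : set R))) => //.
        by move=> r /=; rewrite !in_itv/= !andbT; exact: lt_le_trans.
      apply: open_continuous_measurable_fun => // r.
      by rewrite inE/= in_itv/= andbT; exact: cg.
    - move=> r; rewrite in_itv/= andbT => er; apply: tailZ.
      exact: lt_le_trans er.
  rewrite (@ge0_continuous_FTC2y _ g F e (sup (range F))).
  - rewrite -EFinB lee_fin lerB// /F H_nd ?sqrtr_ge0//.
  - by move=> r er; apply: g0; exact: lt_le_trans er.
  - apply/continuous_within_itvcyP; split.
      move=> r; rewrite in_itv/= andbT => er; apply: cg; exact: lt_trans er.
    by apply: cvg_at_right_filter; exact: cg.
  - exact: Fl.
  - by move=> r er; have [] := dF r (lt_trans e0 er).
  - apply: cvg_at_right_filter; apply: differentiable_continuous.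
    by apply/derivable1_diffP; have [] := dF e e0.
  - by move=> r; rewrite in_itv/= andbT => er; apply: FE; exact: lt_trans er.
rewrite (@itv_bndbnd_setU _ _ (BLeft 0) (BLeft e))//; last 1 first.
  by rewrite bnd_simp ltW.
rewrite ge0_integral_setU//=.
- by rewrite addeC leeD.
- exact: mccdf.
- apply/disj_setPS => r [] /=; rewrite !in_itv/= andbT => /andP[_ re] er.
  by have := lt_le_trans re er; rewrite ltxx.
Qed.

End layer_cake.

(** * Counting independent events *)

Section event_count.
Context d (T : measurableType d) (R : realType) (P : probability T R).
Variables (n : nat) (A : 'I_n -> set T) (p : R).
Hypothesis mA : forall i, measurable (A i).
Hypothesis PA : forall J : {set 'I_n},
  P (\bigcap_(i in [set` J]) A i) = (p ^+ #|J|)%:E.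

Definition event_count (w : T) : nat := #|[set i | w \in A i]%SET|.

(** At least m events occur exactly when all those of some J with at least m indices do; there are
    finitely many such J. *)
Lemma measurable_event_count m : measurable [set w | (m <= event_count w)%N].
Proof.
have -> : [set w | (m <= event_count w)%N] =
    \bigcup_(J in [set J : {set 'I_n} | (m <= #|J|)%N])
      \bigcap_(i in [set` J]) A i.
  apply/seteqP; split => [w /= mw|w /= [J mJ JA]].
    exists [set i | w \in A i]%SET; first exact: mw.
    by move=> i /=; rewrite inE => /set_mem.
  apply: leq_trans mJ _; apply: subset_leq_card; apply/fintype.subsetP => i iJ.
  by rewrite inE; apply/mem_set/JA.
apply: fin_bigcup_measurable => // J _.
by apply: fin_bigcap_measurable.
Qed.

(* [x ^ N = \prod_i (1 + (x - 1) 1_(A_i))] expands into a combination of the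
   indicators of the intersections [\bigcap_(i in J) A_i]. *)
Lemma chernoff_event_count m x : 1 <= x ->
  (P [set w | (m <= event_count w)%N] <=
   ((1 + p * (x - 1)) ^+ n / x ^+ m)%:E)%E.
Proof.
move=> x1; have x0 : 0 < x by exact: lt_le_trans x1.
have y0 : 0 <= x - 1 by rewrite subr_ge0.
set E := [set w | _]; have mE : measurable E by exact: measurable_event_count.
pose AJ (J : {set 'I_n}) := \bigcap_(i in [set` J]) A i.
have mAJ J : measurable (AJ J) by apply: fin_bigcap_measurable.
have powE w : x ^+ event_count w =
    \sum_(J : {set 'I_n}) (x - 1) ^+ #|J| * \1_(AJ J) w.
  have -> : x ^+ event_count w = \prod_i ((x - 1) * \1_(A i) w + 1).
    rewrite /event_count -prodr_const big_mkcond/=; apply: eq_bigr => i _.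
    rewrite inE indicE; case: (w \in A i); first by rewrite mulr1 subrK.
    by rewrite mulr0 add0r.
  rewrite bigA_distr; apply: eq_bigr => J _.
  rewrite -big_mkcond/= big_split/= prodr_const; congr (_ * _).
  rewrite indicE; have [wJ|wJ] := boolP (w \in AJ J).
    rewrite big1// => i iJ; rewrite indicE mem_set//.
    by move/set_mem : wJ; exact.
  have [i iJ wi] : exists2 i, i \in J & w \notin A i.
    apply/exists_inP; apply: contraNT wJ; rewrite negb_exists_in => /forall_inP wA.
    by apply/mem_set => i /= /wA; rewrite negbK => /set_mem.
  by rewrite (bigD1 i)//= indicE (negbTE wi) mul0r.
(* The pointwise form of Markov's inequality for x ^ N. *)
have pw w : ((x ^+ m)%:E * (\1_E w)%:E <=
    \sum_(J : {set 'I_n}) ((x - 1) ^+ #|J|)%:E * (\1_(AJ J) w)%:E)%E.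
  under eq_bigr do rewrite -EFinM.
  rewrite sumEFin -powE -EFinM lee_fin indicE.
  have [/set_mem wE|_] := boolP (w \in E).
    by rewrite mulr1 ler_weXn2l.
  by rewrite mulr0 exprn_ge0// ltW.
(* The same expansion read backwards, p replacing each indicator: this is the binomial generating
   function. *)
have sumE : \sum_(J : {set 'I_n}) (x - 1) ^+ #|J| * p ^+ #|J| = (1 + p * (x - 1)) ^+ n.
  have -> : (1 + p * (x - 1)) ^+ n = \prod_(i < n) ((x - 1) * p + 1).
    by rewrite prodr_const card_ord addrC mulrC.
  rewrite bigA_distr; apply: eq_bigr => J _.
  by rewrite -big_mkcond/= prodr_const exprMn.
rewrite EFinM lee_pdivlMr ?exprn_gt0// muleC -(setIT E) -integral_indic//.
rewrite -ge0_integralZl_EFin//; last 2 first.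
- by apply/measurable_EFinP; exact: measurable_indic.
- by rewrite exprn_ge0// ltW.
have mI J : measurable_fun setT
    (fun w => ((x - 1) ^+ #|J : {set 'I_n}|)%:E * (\1_(AJ J) w)%:E)%E.
  by apply: measurable_funeM; apply/measurable_EFinP; exact: measurable_indic.
apply: (@le_trans _ _ (\int[P]_w
    \sum_(J : {set 'I_n}) ((x - 1) ^+ #|J|)%:E * (\1_(AJ J) w)%:E)%E).
  apply: ge0_le_integral => //.
  - by move=> w _; rewrite mule_ge0// lee_fin exprn_ge0// ltW.
  - by apply: measurable_funeM; apply/measurable_EFinP; exact: measurable_indic.
  - exact: emeasurable_sum.
rewrite ge0_integral_sum//; last first.
  by move=> J w _; rewrite mule_ge0// lee_fin exprn_ge0.
rewrite -sumE -sumEFin; apply: lee_sum => J _.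
rewrite ge0_integralZl_EFin//; last 2 first.
- by apply/measurable_EFinP; exact: measurable_indic.
- by rewrite exprn_ge0.
by rewrite integral_indic// setIT EFinM -PA.
Qed.

End event_count.

(** * Order statistics and exceedance counts *)

Section order_statistics.
Variable R : realType.

(** In a non-increasing list the entries above t form a prefix, whose length is their count. *)
Lemma lt_nth_sorted (t : R) (s : seq R) i : sorted >=%R s -> (i < size s)%N ->
  (t < nth 0 s i) = (i < count (fun y => (t < y)%R) s)%N.
Proof.
elim: s i => [|y s IH] i //= ys.
have s_sorted := path_sorted ys.
have all_le : all (fun z => z <= y) s.
  by apply: order_path_min ys => a b c /= ba cb; exact: le_trans cb ba.
have [ty|yt] := ltP t y.
  by case: i => [|i] //= is_; rewrite IH// add1n ltnS.
have -> : count [eta > t] s = 0%N.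
  apply/eqP; rewrite -leqn0 leqNgt -has_count; apply/hasPn => z zs.
  by rewrite -leNgt (le_trans _ yt)//; move/allP: all_le; exact.
case: i => [|i] /= is_; first by rewrite ltNge yt.
rewrite ltNge (le_trans _ yt)//.
by move/allP: all_le; apply; exact: mem_nth.
Qed.

Lemma lt_order_stat (n : nat) (x : 'I_n -> R) k t : (0 < k)%N -> (k <= n)%N ->
  (t < order_stat x k) = (k <= #|[set i | (t < x i)%R]%SET|)%N.
Proof.
(* Rank k + 1 sits at position k, and k < n keeps [nth] off its default value. *)
case: k => // k _ kn.
rewrite /order_stat/= lt_nth_sorted.
- by rewrite count_sort count_map cardsE cardE size_filter -enumT.
- by apply: sort_sorted => a b; exact: le_total.
- by rewrite size_sort size_map size_enum_ord.
Qed.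

End order_statistics.

(** * Order statistics of a Gaussian sample *)

(** Variance is invariant under translation by a, and Var W = E W^2 - (E W)^2. The finite bound M
    also supplies the square integrability of W. *)
Lemma variance_le_sqr d (T : measurableType d) (R : realType) (P : probability T R)
    (X : T -> R) (a M : R) : measurable_fun setT X ->
  (\int[P]_w ((X w - a) ^+ 2)%:E <= M%:E)%E -> ('V_P[X] <= M%:E)%E.
Proof.
move=> mX XM; pose W w := X w - a.
have mW : measurable_fun setT W by exact: measurable_funB.
have W2 : W \in Lfun P 2%:E.
  rewrite inE/=; apply/andP; split; rewrite inE//=.
  rewrite /finite_norm unlock poweR_lty//.
  under eq_integral => x _ /= do rewrite powR_mulrn// real_normK ?num_real//.
  exact: le_lt_trans XM (ltry _).
have -> : X = (W \+ cst a)%R by apply/funext => w; rewrite /W/= subrK.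
rewrite varianceD_cst_r// varianceE//.
apply: (@le_trans _ _ ('E_P[W ^+ 2])%E); last by rewrite unlock.
have W1 : W \in Lfun P 1 by apply: Lfun_subset12 W2; exact: fin_num_measure.
rewrite leeBlDr; last by rewrite fin_numX// expectation_fin_num.
by rewrite leeDl// sqre_ge0.
Qed.

Lemma expr1D_le (R : realType) (y : R) n : -1 <= y ->
  (1 + y) ^+ n <= expR (n%:R * y).
Proof.
move=> y1; rewrite expRM_natl lerXn2r ?nnegrE ?expR_ge0 ?expR_ge1Dx//.
by rewrite -lerBlDl sub0r.
Qed.

Section gaussian_order_statistic.
Context d (T : measurableType d) (R : realType) (P : probability T R).
Variables (n : nat) (G : 'I_n -> {RV P >-> R}).
Hypothesis hindep : mutually_independent P G.
Hypothesis hgauss : forall i, standard_gaussian P (G i).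
Variable k : nat.
Hypotheses (k_gt0 : (0 < k)%N) (k_le_n : (k <= n)%N).

Let X (w : T) : R := order_stat (fun i => `|G i w|) k.

Let kR_gt0 : 0 < k%:R :> R. Proof. by rewrite ltr0n. Qed.
Let nR_gt0 : 0 < n%:R :> R. Proof. by rewrite ltr0n (leq_trans k_gt0). Qed.

(** Supplies the product hypothesis on intersections required by the Chernoff bound. *)
Lemma gaussian_bigcap (B : set R) (q : R) : measurable B ->
  normal_prob 0 1 B = q%:E -> forall J : {set 'I_n},
  P (\bigcap_(i in [set` J]) G i @^-1` B) = (q ^+ #|J|)%:E.
Proof.
move=> mB Bq J; rewrite (hindep J (fun=> mB)).
under eq_bigr => i _ do rewrite [P _](hgauss i mB) Bq.
by rewrite -(big_morph EFin (@EFinM R) (erefl 1%E)) prodr_const.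
Qed.

Let above t := [set y : R | t < `|y|].

Let measurable_above t : measurable (above t).
Proof.
rewrite (_ : above t = (@Num.norm _ R) @^-1` `]t, +oo[); last first.
  by apply/seteqP; split => y /=; rewrite in_itv/= andbT.
rewrite -[X in measurable X]setTI.
by apply: normr_measurable => //; exact: measurable_itv.
Qed.

Let mG (B : set R) i : measurable B -> measurable (G i @^-1` B).
Proof. by move=> mB; rewrite -[X in measurable X]setTI; exact: measurable_funP. Qed.

Lemma lt_abs_order_stat t :
  [set w | t < X w] =
  [set w | (k <= event_count (fun i => G i @^-1` above t) w)%N].
Proof.
apply/seteqP; split => w /=; rewrite /X lt_order_stat// /event_count.
  by move=> h; rewrite (leq_trans h)// subset_leq_card//; apply/fintype.subsetP => i;
    rewrite inE => ti; rewrite inE; exact/mem_set.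
by move=> h; rewrite (leq_trans h)// subset_leq_card//; apply/fintype.subsetP => i;
    rewrite inE => /set_mem ti; rewrite inE.
Qed.

(** Fewer than k values exceed t exactly when more than n - k do not. *)
Lemma le_abs_order_stat t :
  [set w | X w <= t] =
  [set w | (n - k < event_count (fun i => G i @^-1` ~` above t) w)%N].
Proof.
have E w : (X w <= t) = (n - k < event_count (fun i => G i @^-1` ~` above t) w)%N.
  rewrite leNgt /X lt_order_stat// -ltnNge /event_count.
  have -> : [set i | w \in G i @^-1` ~` above t]%SET =
      (~: [set i | (t < `|G i w|)%R])%SET.
    apply/setP => i; rewrite inE finset.in_setC inE.
    apply/idP/idP => [/set_mem/negP//|/negP ti].
    exact/mem_set.
  have := cardsC [set i | (t < `|G i w|)%R]%SET; rewrite card_ord.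
  by lia.
by apply/seteqP; split => w /=; rewrite E.
Qed.

Lemma measurable_abs_order_stat : measurable_fun setT X.
Proof.
move=> mT; apply: (measurability _ (RGenOInfty.measurableE R)) => //.
move=> _ [_ [t ->] <-]; rewrite setTI.
rewrite (_ : X @^-1` `]t, +oo[ = [set w | t < X w]); last first.
  by apply/seteqP; split => y /=; rewrite in_itv/= andbT.
by rewrite lt_abs_order_stat; apply: measurable_event_count => i; exact: mG.
Qed.

Variables (a : R).
Hypotheses (a_ge0 : 0 <= a) (aE : half_normal_tail a = k%:R / n%:R).
Let h := half_normal_hazard a.
Let h_gt0 : 0 < h. Proof. exact: half_normal_hazard_gt0. Qed.

(** Chernoff's bound with parameter exp(u) gives at most exp(n q (exp(u) - 1) - k u), where n q <= k
    exp(- u). *)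
Lemma prob_order_stat_upper u : 0 <= u ->
  (P [set w | a + u / h < X w]%R <= (upper_tail k u)%:E)%E.
Proof.
move=> u0; have t0 : 0 <= a + u / h by rewrite addr_ge0// divr_ge0// ltW.
have q0 := half_normal_tail_ge0 t0.
set q := half_normal_tail _ in q0.
have qle : q <= k%:R / n%:R * expR (- u).
  have hu : u = h * (u / h) by rewrite mulrC divfK ?gt_eqF.
  rewrite -aE [X in expR (- X)]hu.
  by apply: half_normal_tail_right => //; rewrite divr_ge0// ltW.
have x1 : 1 <= expR u by rewrite -expR0 ler_expR.
rewrite lt_abs_order_stat.
apply: le_trans (chernoff_event_count _ (gaussian_bigcap _ (half_normal_tail_prob t0)) k x1) _.
- by move=> i; apply: mG; exact: measurable_above.
- exact: measurable_above.
have y0 : 0 <= q * (expR u - 1) by rewrite mulr_ge0// subr_ge0.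
rewrite lee_fin -expRM_natl -expRN.
apply: le_trans (ler_wpM2r (expR_ge0 _) (expr1D_le n _)) _; first exact: le_trans y0.
rewrite -expRD ler_expR.
have : n%:R * (q * (expR u - 1)) <= k%:R * (1 - expR (- u)).
  apply: (@le_trans _ _ (n%:R * (k%:R / n%:R * expR (- u) * (expR u - 1)))).
    by rewrite ler_wpM2l ?ler0n// ler_wpM2r// subr_ge0.
  rewrite le_eqVlt; apply/orP; left; apply/eqP.
  rewrite expRN; field.
  by rewrite !gt_eqF ?expR_gt0.
have -> : - (k%:R * (u - 1 + expR (- u))) = k%:R * (1 - expR (- u)) - k%:R * u by ring.
by rewrite lerD2r.
Qed.

(** Chernoff's bound with parameter 1 + u is applied to the values not exceeding the threshold, at
    least n - k + 1 in number; then n q >= k (1 + u) is used. *)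
Lemma prob_order_stat_lower u : 0 <= u ->
  (P [set w | X w < a - u / h]%R <= (lower_tail k u)%:E)%E.
Proof.
move=> u0; have uh0 : 0 <= u / h by rewrite divr_ge0// ltW.
have lt0 : 0 <= lower_tail k u by rewrite mulr_ge0 ?expR_ge0// exprn_ge0// addr_ge0.
(* For a negative threshold the event is empty: if X w < 0, all n values exceed X w, which forces X
   w < X w. *)
have [ua|au] := leP (u / h) a; last first.
  rewrite (_ : [set w | _] = set0) ?measure0//.
  rewrite -subset0 => w /= Xw.
  have X0 : X w < 0 by apply: lt_trans Xw _; rewrite subr_lt0.
  have := lt_order_stat (fun i => `|G i w|) (X w) k_gt0 k_le_n.
  rewrite ltxx => /esym/negbT/negP; apply; apply: leq_trans k_le_n _.
  rewrite -[X in (X <= _)%N]card_ord -cardsT; apply: subset_leq_card.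
  by apply/fintype.subsetP => i _; rewrite inE (lt_le_trans X0).
have t0 : 0 <= a - u / h by rewrite subr_ge0.
have q0 := half_normal_tail_ge0 t0.
set q := half_normal_tail _ in q0.
have qge : k%:R / n%:R * (1 + u) <= q.
  have hu : u = h * (u / h) by rewrite mulrC divfK ?gt_eqF.
  rewrite -aE [X in 1 + X]hu.
  exact: half_normal_tail_left.
have y1 : 1 <= 1 + u by rewrite lerDl.
have y0 : 0 < 1 + u by exact: lt_le_trans y1.
have qC : normal_prob 0 1 (~` above (a - u / h)) = (1 - q)%:E.
  have mA := measurable_above (a - u / h).
  by rewrite [LHS](probability_setC (normal_prob (0 : R) 1) mA) EFinB -half_normal_tail_prob.
have mX := measurable_abs_order_stat.
apply: (@le_trans _ _ (P [set w | X w <= a - u / h])).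
  rewrite le_measure ?inE//.
  - rewrite (_ : [set w | _] = setT `&` X @^-1` `]-oo, a - u / h[%classic).
      by apply: mX => //; exact: measurable_itv.
    by rewrite setTI; apply/seteqP; split => w /=; rewrite in_itv.
  - rewrite (_ : [set w | _] = setT `&` X @^-1` `]-oo, a - u / h]%classic).
      by apply: mX => //; exact: measurable_itv.
    by rewrite setTI; apply/seteqP; split => w /=; rewrite in_itv.
  - by move=> w /= /ltW.
rewrite le_abs_order_stat.
apply: le_trans (chernoff_event_count _ (gaussian_bigcap _ qC) (n - k).+1 y1) _.
- by move=> i; apply: mG; apply: measurableC; exact: measurable_above.
- by apply: measurableC; exact: measurable_above.
rewrite lee_fin.
have -> : 1 + (1 - q) * (1 + u - 1) = (1 + u) * (1 + - (q * u / (1 + u))).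
  by field; rewrite gt_eqF.
(* Needed for the base 1 - q u / (1 + u) to be nonnegative. *)
have q1 : q <= 1.
  rewrite -lee_fin -half_normal_tail_prob//.
  exact: (probability_le1 (normal_prob (0 : R) 1) (measurable_above _)).
(* Cancelling (1 + u)^(n - k + 1) leaves the factor (1 + u)^(k - 1). *)
have nE : n = (k.-1 + (n - k).+1)%N by rewrite addnS -addSn prednK// subnKC.
rewrite exprMn {1}nE exprD mulrAC mulfK ?expf_neq0 ?gt_eqF//.
rewrite ler_wpM2l ?exprn_ge0 ?(ltW y0)//.
apply: le_trans (expr1D_le n _) _.
  rewrite lerN2 ler_pdivrMr// mul1r.
  apply: (@le_trans _ _ (1 * u)); first by rewrite ler_wpM2r.
  by rewrite mul1r lerDr.
rewrite ler_expR mulrN lerN2 mulrA ler_pdivlMr//.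
apply: (@le_trans _ _ (n%:R * (k%:R / n%:R * (1 + u) * u))).
  by rewrite le_eqVlt; apply/orP; left; apply/eqP; field; rewrite gt_eqF.
by rewrite ler_wpM2l ?ler0n// ler_wpM2r.
Qed.

(** The second moment bound is applied to Y = h |X - a|: the event Y > u is covered by the two tail
    events, and dividing by h^2 restores the scale. *)
Lemma abs_order_stat_sqr_dev :
  (\int[P]_w ((X w - a) ^+ 2)%:E <=
   ((2 * expR 1 + 2) / (k%:R * h ^+ 2))%:E)%E.
Proof.
pose Y w := h * `|X w - a|.
have mX := measurable_abs_order_stat.
have mXa : measurable_fun setT (fun w => X w - a) by exact: measurable_funB.
have mY : measurable_fun setT Y.
  by apply: measurable_funM => //; exact: measurableT_comp.
have Y0 w : 0 <= Y w by rewrite mulr_ge0// ltW.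
have := integral_sqr_le (P := P) mY Y0 (is_derive_tail_primitive k_gt0)
  (@continuous_tail_density R k) _ (@tail_primitive_le R k).
rewrite tail_primitive0.
have -> : (\int[P]_w (Y w ^+ 2)%:E)%E =
    ((h ^+ 2)%:E * \int[P]_w ((X w - a) ^+ 2)%:E)%E.
  rewrite -ge0_integralZl_EFin//.
  - by apply: eq_integral => w _; rewrite -EFinM /Y exprMn real_normK// num_real.
  - by move=> w _; rewrite lee_fin sqr_ge0.
  - by apply/measurable_EFinP; exact: measurable_funX.
  - exact: sqr_ge0.
move=> H.
have -> : (2 * expR 1 + 2) / (k%:R * h ^+ 2) =
    (2 * expR 1 / k%:R - - (2 / k%:R)) / h ^+ 2.
  by field; rewrite !gt_eqF.
rewrite EFinM lee_pdivlMr ?exprn_gt0// muleC; apply: H => u u0.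
apply: (@le_trans _ _ ((2 * u)%:E * (upper_tail k u + lower_tail k u)%:E)%E);
  last by rewrite -EFinM lee_fin tail_density_ge// ltW.
rewrite lee_wpmul2l ?lee_fin ?mulr_ge0 ?(ltW u0)//.
have mU : measurable [set w | a + u / h < X w].
  rewrite (_ : [set w | _] = setT `&` X @^-1` `]a + u / h, +oo[%classic).
    by apply: mX => //; exact: measurable_itv.
  by rewrite setTI; apply/seteqP; split => w /=; rewrite in_itv/= andbT.
have mL : measurable [set w | X w < a - u / h].
  rewrite (_ : [set w | _] = setT `&` X @^-1` `]-oo, a - u / h[%classic).
    by apply: mX => //; exact: measurable_itv.
  by rewrite setTI; apply/seteqP; split => w /=; rewrite in_itv/=.
rewrite EFinD; apply: (@le_trans _ _
    (P [set w | a + u / h < X w]%R + P [set w | X w < a - u / h]%R)%E); last first.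
  by apply: leeD; [exact: prob_order_stat_upper (ltW u0)|
                   exact: prob_order_stat_lower (ltW u0)].
apply: le_trans (measureU2 _ mU mL).
rewrite le_measure ?inE//; last 2 first.
- exact: measurableU.
- move=> w /=; rewrite /Y mulrC -ltr_pdivrMr// lter_normr => /orP[uX|uX].
    by left; lra.
  by right; lra.
rewrite (_ : [set w | _] = setT `&` Y @^-1` `]u, +oo[%classic).
  by apply: mY => //; exact: measurable_itv.
by rewrite setTI; apply/seteqP; split => w /=; rewrite in_itv/= andbT.
Qed.


End gaussian_order_statistic.

(** Let L = ln z, so that L >= 1. Applying ln x <= x / 2 - 3/10 to L and to z gives 1 + 4 ln L <= 2
    L - 1/5 <= z - 4/5 < z, hence positivity; the subtracted logarithm is nonnegative as ln L >=
    0. *)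
Lemma log_denominator_bounds (R : realType) (z : R) (k : nat) : (0 < k)%N -> 4 <= z ->
  0 < ln z - ln (1 + 4 / k%:R * ln (ln z)) <= ln z.
Proof.
move=> k0 z4; have z0 : 0 < z by lra.
have L1 : 1 <= ln z.
  rewrite -ler_expR lnK ?posrE//; apply: le_trans z4.
  by have := expR1_le R; lra.
have ll0 : 0 <= ln (ln z) by exact: ln_ge0.
have ln_half (x : R) : 0 < x -> ln x <= x / 2 - 3 / 10.
  move=> x0; have -> : x = 2 * (x / 2) by lra.
  rewrite lnM ?posrE ?divr_gt0//; have := ln2_le R.
  by have := ln_le_subr1 (divr_gt0 x0 (ltr0n R 2)); lra.
have k4 : 4 / k%:R * ln (ln z) <= 4 * ln (ln z).
  by rewrite ler_wpM2r// ler_pdivrMr ?ltr0n// ler_peMr// ler1n.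
have k40 : 0 <= 4 / k%:R * ln (ln z) by rewrite mulr_ge0// divr_ge0.
apply/andP; split; last by rewrite gerBl ln_ge0// lerDl.
rewrite subr_gt0 ltr_ln ?posrE//; last lra.
have := ln_half _ z0; have := ln_half _ (lt_le_trans ltr01 L1); lra.
Qed.

Theorem proposition4p2 (R : realType) (d : measure_display)
    (T : measurableType d) (P : probability T R) (n : nat) (hn : (3 <= n)%N)
    (G : 'I_n -> {RV P >-> R})
    (hindep : mutually_independent P G)
    (hgauss : forall i, standard_gaussian P (G i))
    (k : nat) (hk1 : (1 <= k)%N) (hkn : k%:R <= n%:R / 2 :> R) :
  ('V_P[fun w : T => order_stat (fun i => `|G i w|%R) k] <=
   (1 / (k%:R * ln 2) *
    (8 / (ln (2 * n%:R / k%:R)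
          - ln (1 + 4 / k%:R * ln (ln (2 * n%:R / k%:R))))))%:E)%E.
Proof.
have kR : 0 < k%:R :> R by rewrite ltr0n.
have nR : 0 < n%:R :> R by lra.
have k_le_n : (k <= n)%N by rewrite -(ler_nat R); lra.
have s0 : 0 < k%:R / n%:R :> R by rewrite divr_gt0.
have s2 : k%:R / n%:R <= 1 / 2 :> R by rewrite ler_pdivrMr//; lra.
have [a a0 aE] : exists2 a : R, 0 <= a & half_normal_tail a = k%:R / n%:R.
  by apply: half_normal_tail_surj => //; lra.
have hlog := half_normal_hazard_log a0; rewrite aE in hlog.
have {hlog} := hlog s2.
have h0 := half_normal_hazard_gt0 a0.
have dev := abs_order_stat_sqr_dev hindep hgauss hk1 k_le_n a0 aE.
move: h0 dev; set h := half_normal_hazard a => h0 dev.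
have zE : 2 / (k%:R / n%:R) = 2 * n%:R / k%:R :> R by field; rewrite !gt_eqF.
rewrite zE; set z := 2 * n%:R / k%:R => hL.
have z4 : 4 <= z by rewrite ler_pdivlMr//; lra.
have /andP[D0 DL] := log_denominator_bounds hk1 z4.
apply: (variance_le_sqr (a := a)).
  exact: measurable_abs_order_stat.
apply: le_trans dev _; rewrite lee_fin.
set D := ln z - _ in D0 DL *.
have ln20 : 0 < ln 2 :> R by apply: ln_gt0; lra.
have e0 := expR_gt0 (1 : R).
(* This is (2 e + 2) / (k h^2) <= 8 / (k D ln 2) with denominators cleared; it follows from D <= ln
   z and the hazard bound. *)
have hD : ln 2 * (1 + expR 1) * D <= 4 * h ^+ 2.
  have : ln 2 * (1 + expR 1) / 4 * D <= ln 2 * (1 + expR 1) / 4 * ln z.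
    by rewrite ler_wpM2l// divr_ge0// mulr_ge0 ?addr_ge0// ltW.
  by lra.
have -> : 1 / (k%:R * ln 2) * (8 / D) = 8 / (k%:R * (ln 2 * D)).
  by field; rewrite !gt_eqF.
rewrite ler_pdivrMr; last by rewrite mulr_gt0// exprn_gt0.
rewrite mulrAC ler_pdivlMr; last by rewrite !mulr_gt0.
rewrite [leLHS](_ : _ = k%:R * (2 * (ln 2 * (1 + expR 1) * D))); last by ring.
rewrite [leRHS](_ : _ = k%:R * (2 * (4 * h ^+ 2))); last by ring.
by rewrite ler_wpM2l// ?(ltW kR)// ler_wpM2l.
Qed.
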